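(* Let $\Theta\subset\mathbb{R}^d$ be open, let $X_1,\ldots,X_n$ be i.i.d. with law $\mathbf{P}_\theta$, $\theta\in\Theta$, and let $\hat\theta_n=\hat\theta_n(X_1,\ldots,X_n)$ be a consistent estimator of $\theta\in\Theta$. Let $\theta_0\in\Theta$, and let $\Omega\subset\mathbb{R}^d$ be an open set such that $0\notin\Omega$ and $\theta_0+\Omega\subset\Theta$. Then for any $\tilde\theta\in\theta_0+\Omega$, $$\liminf_{n\to\infty}\frac1n\log\mathbf{P}_{\theta_0}\bigl(\hat\theta_n-\theta_0\in\Omega\bigr)\ge-\int_S\log\frac{f(x,\tilde\theta)}{f(x,\theta_0)}\,f(x,\tilde\theta)\,\mu(dx).$$
   Context: $\mathbf{P}_\theta$, $\theta\in\Theta$, are probability measures on $(S,\mathcal{B})$, absolutely continuous with respect to a probability measure $\mu$, with densities $f(x,\theta)=\frac{d\mathbf{P}_\theta}{d\mu}(x)$. Probabilities of events depending on $X_1,\ldots,X_n$ are computed for i.i.d. observations with law $\mathbf{P}_\theta$ (also denoted by $\mathbf{P}_\theta$). Consistency: for every $\theta\in\Theta$ and every $\varepsilon>0$, $\lim_{n\to\infty}\mathbf{P}_\theta(|\hat\theta_n-\theta|>\varepsilon)=0$. The integral on the right is the Kullback–Leibler divergence of $\mathbf{P}_{\tilde\theta}$ from $\mathbf{P}_{\theta_0}$, with values in $[0,+\infty]$; $\log0=-\infty$. *)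

(* Defs.v *)
From mathcomp Require Import all_boot all_order all_algebra.
From mathcomp Require Import finmap.
From mathcomp Require Import all_classical all_reals all_analysis.

Set Implicit Arguments.
Unset Strict Implicit.
Unset Printing Implicit Defensive.

Import Order.TTheory GRing.Theory Num.Theory.
Import numFieldNormedType.Exports.

Local Open Scope classical_set_scope.
Local Open Scope ring_scope.

(* Euclidean norm; the library norm `|v| on 'rV[R]_d is the sup norm. *)
Definition enorm (R : realType) (d : nat) (v : 'rV[R]_d) : R :=
  Num.sqrt (\sum_(i < d) v ord0 i ^+ 2).

Definition borel_measurable (R : realType) (d : nat) (dT : measure_display)
    (T : measurableType dT) (g : T -> 'rV[R]_d) : Prop :=
  measurable_fun [set: T] (g : T -> g_sigma_algebraType (@open 'rV[R]_d)).

Definition is_density (R : realType) (dS : measure_display)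
    (S : measurableType dS) (mu P : probability S R) (p : S -> R) : Prop :=
  [/\ measurable_fun [set: S] p,
      forall x, 0 <= p x &
      forall B : set S, measurable B -> P B = (\int[mu]_(x in B) (p x)%:E)%E].

Definition mutually_independent (R : realType) (dO dS : measure_display)
    (O : measurableType dO) (S : measurableType dS) (Pr : probability O R)
    (X : nat -> O -> S) : Prop :=
  forall (J : {fset nat}) (B : nat -> set S),
    (forall i, measurable (B i)) ->
    Pr (\bigcap_(i in [set` J]) X i @^-1` B i) =
    (\prod_(i <- J) Pr (X i @^-1` B i))%E.

Definition iid_with_law (R : realType) (dO dS : measure_display)
    (O : measurableType dO) (S : measurableType dS) (Pr : probability O R)
    (X : nat -> O -> S) (P : probability S R) : Prop :=
  [/\ forall i, measurable_fun [set: O] (X i),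
      forall i (B : set S), measurable B -> Pr (X i @^-1` B) = P B &
      mutually_independent Pr X].

Definition sample (O S : Type) (X : nat -> O -> S) (n : nat) (w : O) :
    n.-tuple S :=
  [tuple X i w | i < n].

Definition consistent (R : realType) (d : nat) (dO dS : measure_display)
    (O : measurableType dO) (S : measurableType dS)
    (Theta : set 'rV[R]_d) (Pr : 'rV[R]_d -> probability O R)
    (X : nat -> O -> S) (est : forall n : nat, n.-tuple S -> 'rV[R]_d) : Prop :=
  forall theta : 'rV[R]_d, Theta theta -> forall eps : R, 0 < eps ->
    Pr theta [set w | eps < enorm (est n (sample X n w) - theta)]
      @[n --> \oo] --> 0%E.

(* Main.v *)
(* Let l := log (f(., theta0) / f(., theta1)), so that E_1 l = -KL when KL is
   finite, and let A be the event that the estimator lands in theta0 + Omega.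
   The likelihood ratio of P_0 to P_1 on the sample is e^L with
   L = l(X_1) + ... + l(X_n), hence P_0(A) >= E_1[e^L; A], while
   E_1[L; not A] <= E_1[e^L; not A] <= 1.  Jensen's inequality on A, with
   p = P_1(A), gives P_0(A) >= p exp((-n KL - 1) / p).  Consistency at theta1
   gives p -> 1, and no law of large numbers is needed. *)

Require Import Defs.
From HB Require Import structures.
From mathcomp Require Import all_boot all_order all_algebra.
From mathcomp Require Import finmap.
From mathcomp Require Import all_classical all_reals all_analysis.
From mathcomp Require Import measurable_realfun.
Import Order.TTheory GRing.Theory Num.Theory.
Import numFieldNormedType.Exports.
Local Open Scope classical_set_scope.
Local Open Scope ring_scope.

Set Implicit Arguments.
Unset Strict Implicit.
Unset Printing Implicit Defensive.

(** * Change of variables for the image of a measure with density *)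

Section density.
Context d1 d2 (T : measurableType d1) (T' : measurableType d2) (R : realType).
Variables (m : {measure set T -> \bar R}) (nu : {measure set T' -> \bar R}).
Variables (Y : T -> T') (D : T -> R).
Hypotheses (mY : measurable_fun [set: T] Y) (mD : measurable_fun [set: T] D).
Hypothesis D0 : forall w, 0 <= D w.
Hypothesis nuE : forall B, measurable B ->
  (\int[m]_(w in Y @^-1` B) (D w)%:E = nu B)%E.

Import HBNNSimple.

Let mpre B : measurable B -> measurable (Y @^-1` B).
Proof. by move=> mB; rewrite -[_ @^-1` _]setTI; exact: mY. Qed.

(** [nuE] is the case of an indicator; a simple function is a finite combination of indicators of
    its level sets, and both sides are additive. *)
Let integral_density_nnsfun (g : {nnsfun T' >-> R}) :
  (\int[m]_w ((g (Y w))%:E * (D w)%:E) = \int[nu]_x (g x)%:E)%E.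
Proof.
under [RHS]eq_integral do rewrite fimfunE -fsumEFin//.
rewrite [RHS]ge0_integral_fsum//; last 2 first.
  - by move=> r; exact/measurable_EFinP/measurableT_comp.
  - by move=> n x _; rewrite EFinM nnfun_muleindic_ge0.
under [LHS]eq_integral.
  move=> w _; rewrite fimfunE -fsumEFin// ge0_mule_fsuml; last first.
    by move=> r; rewrite EFinM nnfun_muleindic_ge0.
  over.
have mg r : measurable (g @^-1` [set r]) by [].
have mi r : measurable_fun [set: T] (fun w => \1_(g @^-1` [set r]) (Y w) : R).
  by apply: measurableT_comp => //; exact: measurable_indic.
rewrite [LHS]ge0_integral_fsum//; last 2 first.
  - move=> r; apply: emeasurable_funM; apply/measurable_EFinP => //.
    exact: measurable_funM.
  - move=> r w _; apply: mule_ge0; last by rewrite lee_fin.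
    by rewrite EFinM nnfun_muleindic_ge0.
apply: eq_fsbigr => r _.
rewrite integralZl_indic_nnsfun//= integral_indic// setIT -nuE//.
(* Here [r] is an arbitrary real: a negative one has an empty level set, a nonnegative one can be
   moved through the integral. *)
have [r0|r0] := ltP r 0.
  rewrite preimage_nnfun0// preimage_set0 integral_set0 mule0.
  under eq_integral do rewrite indic0 mulr0 mul0e.
  by rewrite integral0.
rewrite -ge0_integralZl//=; last 2 first.
- by apply: measurable_funTS; exact/measurable_EFinP.
- by move=> w _; rewrite lee_fin.
- rewrite [RHS]integral_mkcond; apply: eq_integral => w _.
  rewrite patchE indicE.
  have -> : (w \in Y @^-1` (g @^-1` [set r])) = (Y w \in g @^-1` [set r]).
    by apply/idP/idP; rewrite !inE.
  by case: ifP => _; rewrite ?mulr1// mulr0 mul0e.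
- exact: mpre.
Qed.

(** Monotone convergence along the simple approximations of [g]. Three instances serve below: [D]
    constantly 1 gives the law of an observation, [Y] the identity gives a change of measure on [S],
    and a partial product as [D] splits off one independent factor. *)
Lemma ge0_integral_density (g : T' -> \bar R) : measurable_fun [set: T'] g ->
  (forall x, 0 <= g x)%E ->
  (\int[m]_w (g (Y w) * (D w)%:E) = \int[nu]_x g x)%E.
Proof.
move=> mg g0; pose g_ := nnsfun_approx measurableT mg.
transitivity (lim (\int[m]_w ((g_ n (Y w))%:E * (D w)%:E) @[n --> \oo])%E).
  rewrite -monotone_convergence//=.
  - apply: eq_integral => w _; apply/esym/cvg_lim => //=.
    by apply: cvgeZr => //; exact: cvg_nnsfun_approx.
  - move=> n; apply: emeasurable_funM; apply/measurable_EFinP => //.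
    exact: measurableT_comp.
  - by move=> n w _; rewrite mule_ge0 ?lee_fin.
  - move=> w _ a b ab; apply: lee_wpmul2r; rewrite lee_fin//.
    exact/lefP/nd_nnsfun_approx.
rewrite [RHS](_ : _ = lim (\int[nu]_x (g_ n x)%:E @[n --> \oo])%E); last first.
  rewrite -monotone_convergence//=.
  - apply: eq_integral => x _; apply/esym/cvg_lim => //=.
    exact: cvg_nnsfun_approx.
  - by move=> n; exact/measurable_EFinP.
  - by move=> n x _; rewrite lee_fin.
  - by move=> x _ a b ab; rewrite lee_fin; exact/lefP/nd_nnsfun_approx.
by apply: congr_lim; apply/funext => n; exact: integral_density_nnsfun.
Qed.

Local Open Scope ereal_scope.

(** Multiplication by the nonnegative [D] commutes with taking positive and negative parts, so the
    identity holds without integrability. *)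
Lemma integral_density (g : T' -> R) : measurable_fun [set: T'] g ->
  \int[m]_w (g (Y w) * D w)%:E = \int[nu]_x (g x)%:E.
Proof.
move=> mg; rewrite [LHS]integralE [RHS]integralE; congr (_ - _).
- rewrite -ge0_integral_density; last 2 first.
  + by apply: measurable_funepos; exact/measurable_EFinP.
  + by [].
  apply: eq_integral => w _; rewrite !funeposE.
  by rewrite EFinM maxe_pMl ?lee_fin// mul0e.
- rewrite -ge0_integral_density; last 2 first.
  + by apply: measurable_funeneg; exact/measurable_EFinP.
  + by [].
  apply: eq_integral => w _; rewrite !funenegE.
  by rewrite EFinM -mulNe maxe_pMl ?lee_fin// mul0e.
Qed.

Lemma integrable_density (g : T' -> R) : measurable_fun [set: T'] g ->
  m.-integrable [set: T] (fun w => (g (Y w) * D w)%:E) <->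
  nu.-integrable [set: T'] (EFin \o g).
Proof.
move=> mg; have E : \int[m]_w `|(g (Y w) * D w)%:E| = \int[nu]_x `|(g x)%:E|.
  rewrite -ge0_integral_density//.
    apply: eq_integral => w _.
    by rewrite EFinM abseM (gee0_abs (x := (D w)%:E)) ?lee_fin.
  by apply: measurableT_comp => //; exact/measurable_EFinP.
split=> /integrableP[_ foo]; apply/integrableP; split.
- exact/measurable_EFinP.
- by rewrite -E.
- apply/measurable_EFinP; apply: measurable_funM => //.
  exact: measurableT_comp.
- by rewrite E.
Qed.

End density.

(** * Independence of the first [n] observations and integrals of products *)

Lemma measurable_all_ord (dO dS : measure_display) (O : measurableType dO)
    (S : measurableType dS) (X : nat -> O -> S) (n : nat) (B : nat -> set S) :
  (forall i, measurable_fun [set: O] (X i)) -> (forall i, measurable (B i)) ->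
  measurable [set w | forall i : 'I_n, B i (X i w)].
Proof.
move=> mX mB.
rewrite (_ : mkset _ = \bigcap_(i in `I_n) (X i @^-1` B i)); last first.
  apply/seteqP; split => w Bw i => [ni|]; first exact: (Bw (Ordinal ni)).
  exact/Bw/ltn_ord.
apply: bigcap_measurableType => i _.
by rewrite -[_ @^-1` _]setTI; exact: mX.
Qed.

Lemma independent_prob_all_ord (R : realType) (dO dS : measure_display)
    (O : measurableType dO) (S : measurableType dS) (Pr : probability O R)
    (X : nat -> O -> S) (n : nat) (B : nat -> set S) :
  mutually_independent Pr X -> (forall i, measurable (B i)) ->
  Pr [set w | forall i : 'I_n, B i (X i w)] =
  (\prod_(i < n) Pr (X i @^-1` B i))%E.
Proof.
move=> indX mB; have := indX [fset i | i in iota 0 n]%fset B mB.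
have -> : (\prod_(i <- [fset i | i in iota 0 n]%fset) Pr (X i @^-1` B i) =
    \prod_(i < n) Pr (X i @^-1` B i))%E.
  rewrite -(big_mkord xpredT (fun i => Pr (X i @^-1` B i))) /index_iota subn0.
  apply: perm_big; apply: uniq_perm; rewrite ?fset_uniq ?iota_uniq// => i.
  by rewrite !inE.
move=> <-; congr (Pr _); apply/seteqP; split => [w Bw i /=|w Bw i /=].
  by rewrite !inE mem_iota add0n => /andP[_ lin]; exact: (Bw (Ordinal lin)).
by apply: (Bw (i : nat)); rewrite /= !inE mem_iota ltn_ord.
Qed.

Section independent_product.
Context (R : realType) (dO dS : measure_display).
Context (O : measurableType dO) (S : measurableType dS).
Variables (Pr : probability O R) (X : nat -> O -> S) (P : probability S R).
Hypothesis iidX : iid_with_law Pr X P.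
Local Open Scope ereal_scope.

Let mX i : measurable_fun [set: O] (X i). Proof. by have [] := iidX. Qed.

(* Induction on the number k of factors that are not indicators: fixing all
   factors but the k-th one, both sides are measures in an indicator put in
   place of the k-th factor. *)
Let prod_rec (n k : nat) (phi : nat -> S -> R) : (k <= n)%N ->
  (forall i, measurable_fun [set: S] (phi i)) ->
  (forall i x, (0 <= phi i x)%R) ->
  (forall i, \int[P]_x (phi i x)%:E < +oo) ->
  (forall i, (k <= i)%N -> exists2 B, measurable B & phi i = \1_B) ->
  \int[Pr]_w (\prod_(i < n) phi i (X i w))%:E =
  \prod_(i < n) \int[P]_x (phi i x)%:E.
Proof.
elim: k phi => [|k IH] phi kn mphi phi0 phioo phiB.
  have [_ PX indX] := iidX.
  pose B i := sval (cid2 (phiB i isT)).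
  have mB i : measurable (B i) by rewrite /B; case: cid2.
  have phiE i : phi i = \1_(B i) by rewrite /B; case: cid2.
  (* Base case: a product of indicators is the indicator of a joint event, to which independence
     applies. *)
  transitivity (Pr [set w | forall i : 'I_n, B i (X i w)]).
    transitivity (\int[Pr]_w (\1_[set w | forall i : 'I_n, B i (X i w)] w)%:E).
      apply: eq_integral => w _; congr EFin.
      rewrite indicE; case: (boolP (w \in _)) => [/[!inE]/= Bw|].
        by rewrite big1// => i _; rewrite phiE indicE mem_set.
      rewrite notin_setE/= => /existsNP[i Bi].
      by rewrite (bigD1 i)//= phiE indicE memNset// mul0r.
    by rewrite integral_indic ?setIT//; exact: measurable_all_ord.
  rewrite independent_prob_all_ord//; apply: eq_bigr => i _.
  rewrite PX// phiE integral_indic// ?setIT//.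
pose ik := Ordinal kn.
pose D w : R := (\prod_(i < n | i != ik) phi i (X i w))%R.
pose c := \prod_(i < n | i != ik) \int[P]_x (phi i x)%:E.
have c0 : 0 <= c.
  by apply: prode_ge0 => i _; apply: integral_ge0 => x _; rewrite lee_fin.
have coo : c \is a fin_num.
  rewrite /c; apply: prode_fin_num => i _; rewrite ge0_fin_numE//.
  by apply: integral_ge0 => x _; rewrite lee_fin.
(* The product of the other integrals is finite, so it can scale [P] into the measure [nu] of the
   density lemma. *)
pose c' := NngNum (fine_ge0 c0).
have cE : c'%:num%:E = c by rewrite /= fineK.
have mD : measurable_fun [set: O] D.
  rewrite /D; under eq_fun do rewrite -big_filter.
  by apply: measurable_prod => i _; exact: measurableT_comp.
have D0 w : (0 <= D w)%R by apply: prodr_ge0.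
transitivity (\int[Pr]_w ((phi k (X k w))%:E * (D w)%:E)).
  by apply: eq_integral => w _; rewrite (bigD1 ik).
rewrite (@ge0_integral_density _ _ _ _ _ _ (mscale c' P) (X k) D _ _ _ _
  (EFin \o phi k))//.
- rewrite ge0_integral_mscale//=.
  + by rewrite fineK// [RHS](bigD1 ik)//= muleC.
  + exact/measurable_EFinP.
  + by move=> x _; rewrite lee_fin.
- move=> B mB.
  (* With [\1_B] as factor [k], all factors from [k] on are indicators, so the induction hypothesis
     evaluates the integral over the preimage of [B]. *)
  pose psi i := if i == k then \1_B else phi i.
  transitivity (\int[Pr]_w (\prod_(i < n) psi i (X i w))%:E).
    rewrite integral_mkcond; apply: eq_integral => w _.
    rewrite patchE (bigD1 ik)//= /psi eqxx indicE.
    rewrite (eq_bigr (fun i : 'I_n => phi i (X i w))); last first.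
      by move=> i /negPf; rewrite -val_eqE /= => ->.
    rewrite (_ : (X k w \in B) = (w \in X k @^-1` B)); last first.
      by apply/idP/idP; rewrite !inE.
    by case: ifP => _; rewrite ?mul1r// mul0r.
  rewrite IH.
  + rewrite (bigD1 ik)//= /psi eqxx integral_indic// setIT.
    rewrite /mscale/= fineK// muleC; congr (_ * _).
    by apply: eq_bigr => i /negPf; rewrite -val_eqE /= => ->.
  + exact: ltnW.
  + by move=> i; rewrite /psi; case: ifP.
  + by move=> i x; rewrite /psi; case: ifP.
  + move=> i; rewrite /psi; case: ifP => // _.
    rewrite integral_indic// setIT.
    by rewrite (le_lt_trans (probability_le1 _ _))// ltry.
  + move=> i; rewrite /psi leq_eqVlt => /predU1P[<-|ki].
      by rewrite eqxx; exists B.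
    by rewrite gtn_eqF//; exact: phiB.
- exact/measurable_EFinP.
- by move=> x; rewrite lee_fin.
Qed.

Lemma integral_prod_indep (n : nat) (phi : nat -> S -> R) :
  (forall i, measurable_fun [set: S] (phi i)) ->
  (forall i x, (0 <= phi i x)%R) ->
  (forall i, \int[P]_x (phi i x)%:E < +oo) ->
  \int[Pr]_w (\prod_(i < n) phi i (X i w))%:E =
  \prod_(i < n) \int[P]_x (phi i x)%:E.
Proof.
move=> mphi phi0 phioo.
(* Factors of index [n] or more do not enter the product; making them indicators of the empty set
   meets the last condition of [prod_rec] with [k] equal to [n]. *)
pose psi i := if (i < n)%N then phi i else \1_(set0 : set S).
have psiE (i : 'I_n) : psi i = phi i by rewrite /psi ltn_ord.
transitivity (\int[Pr]_w (\prod_(i < n) psi i (X i w))%:E).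
  by apply: eq_integral => w _; under [in RHS]eq_bigr do rewrite psiE.
rewrite (@prod_rec n n)//.
- by apply: eq_bigr => i _; rewrite psiE.
- by move=> i; rewrite /psi; case: ifP.
- by move=> i x; rewrite /psi; case: ifP.
- move=> i; rewrite /psi; case: ifP => // _.
  by rewrite integral_indic// set0I measure0.
- by move=> i ni; rewrite /psi ltnNge ni; exists set0.
Qed.

End independent_product.

(** * Image measures with density, and the sigma-algebra of samples *)

Section density_image.
Context d1 d2 (T : measurableType d1) (T' : measurableType d2) (R : realType).
Variables (m : {measure set T -> \bar R}) (Y : T -> T') (D : T -> R).
Hypotheses (mY : measurable_fun [set: T] Y) (mD : measurable_fun [set: T] D).
Hypothesis D0 : forall w, 0 <= D w.
Local Open Scope ereal_scope.

(** The image under [Y] of the measure with density [D]. The proofs are arguments so that the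
    measure instance declared below can be inferred from the term. *)
Definition density_image of measurable_fun [set: T] Y &
  measurable_fun [set: T] D & (forall w, 0 <= D w)%R :=
  fun B : set T' => \int[m]_(w in Y @^-1` B) (D w)%:E.

Let di := density_image mY mD D0.

Let di0 : di set0 = 0.
Proof. by rewrite /di /density_image preimage_set0 integral_set0. Qed.

Let di_ge0 B : 0 <= di B.
Proof. by apply: integral_ge0 => w _; rewrite lee_fin. Qed.

Let di_sigma_additive : semi_sigma_additive di.
Proof.
move=> /= F mF tF mUF; rewrite /di /density_image; apply: cvg_toP.
  apply: ereal_nondecreasing_is_cvgn => p q pq.
  by apply: lee_sum_nneg_natr => // k _ _; exact: di_ge0.
rewrite preimage_bigcup ge0_integral_bigcup//=.
- by move=> k; rewrite -[_ @^-1` _]setTI; exact: mY.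
- by apply: measurable_funTS; exact/measurable_EFinP.
- by move=> w _; rewrite lee_fin.
- apply/trivIsetP => i j _ _ ij; rewrite -preimage_setI.
  by move/trivIsetP : tF => -> //; rewrite preimage_set0.
Qed.

HB.instance Definition _ := isMeasure.Build _ _ _ di
  di0 di_ge0 di_sigma_additive.

End density_image.

Section rectangles.
Context (dS : measure_display) (S : measurableType dS) (n : nat).

Definition rectangle (B : nat -> set S) : set (n.-tuple S) :=
  [set t | forall i : 'I_n, B i (tnth t i)].

Definition rectangles : set (set (n.-tuple S)) :=
  [set rectangle B | B in [set B | forall i, measurable (B i)]].

Lemma setI_closed_rectangles : setI_closed rectangles.
Proof.
move=> _ _ [B mB <-] [C mC <-]; exists (fun i => B i `&` C i).
  by move=> i; exact: measurableI.
apply/seteqP; split => [t BC|t [Bt Ct] i]; last by split.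
by split => i; have [] := BC i.
Qed.

(** A coordinate cylinder is a rectangle with full sides elsewhere, and a rectangle is a finite
    intersection of coordinate cylinders. *)
Lemma measurable_tuple_rectangles :
  @measurable _ (n.-tuple S) = <<s rectangles >>.
Proof.
apply/seteqP; split.
  apply: smallest_sub; first exact: smallest_sigma_algebra.
  rewrite -bigcup_seq => A [i _ [C mC <-]].
  apply: sub_sigma_algebra; exists (fun j => if j == i :> nat then C else setT).
    by move=> j; case: ifP.
  rewrite setTI; apply/seteqP; split => [t /(_ i)|t Ct j].
    by rewrite eqxx.
  by case: ifPn => // /eqP /val_inj ->.
apply: smallest_sub; first exact: sigma_algebra_measurable.
move=> _ [B mB <-].
rewrite (_ : rectangle B = \bigcap_(k in `I_n)
    [set t | forall i : 'I_n, i = k :> nat -> B i (tnth t i)]); last first.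
  apply/seteqP; split => [t Bt k _ i _//|t Bt i]; exact: (Bt i (ltn_ord i) i).
apply: bigcap_measurableType => k kn.
rewrite (_ : mkset _ = (fun t => tnth t (Ordinal kn)) @^-1` B k).
  by rewrite -[_ @^-1` _]setTI; exact: measurable_tnth.
apply/seteqP; split => [t Bt|t Bt i ik]; first exact: (Bt (Ordinal kn)).
by rewrite (_ : i = Ordinal kn)//; exact: val_inj.
Qed.

End rectangles.

Lemma measurable_sample (dO dS : measure_display) (O : measurableType dO)
    (S : measurableType dS) (X : nat -> O -> S) (n : nat) :
  (forall i, measurable_fun [set: O] (X i)) ->
  measurable_fun [set: O] (sample X n).
Proof.
move=> mX; apply/measurable_fun_tnthP => i.
rewrite (_ : _ \o _ = X i)//; apply/funext => w.
by rewrite /= tnth_mktuple.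
Qed.

(** * Likelihood ratio of the whole sample *)

Section likelihood.
Context (R : realType) (dO dS : measure_display).
Context (O : measurableType dO) (S : measurableType dS).
Variables (Pr0 Pr1 : probability O R) (X : nat -> O -> S).
Variables (P0 P1 : probability S R) (h : S -> R) (G : set S).
Hypotheses (iid0 : iid_with_law Pr0 X P0) (iid1 : iid_with_law Pr1 X P1).
Hypotheses (mh : measurable_fun [set: S] h) (h0 : forall x, 0 <= h x).
Hypothesis mG : measurable G.
Local Open Scope ereal_scope.
(* P0 need not be dominated by P1: h is the density of its restriction to G. *)
Hypothesis hE : forall B, measurable B ->
  \int[P1]_(x in B) (h x)%:E = P0 (B `&` G).

Let mX i : measurable_fun [set: O] (X i). Proof. by have [] := iid0. Qed.

Let L n (w : O) : R := (\prod_(i < n) h (X i w))%R.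

Let mL n : measurable_fun [set: O] (L n).
Proof. by apply: measurable_prod => i _; exact: measurableT_comp. Qed.

Let L0 n w : (0 <= L n w)%R. Proof. exact: prodr_ge0. Qed.

Let GX n : set O := [set w | forall i : 'I_n, G (X i w)].

Let mGX n : measurable (GX n).
Proof. exact: (@measurable_all_ord _ _ _ _ X n (fun=> G)). Qed.

Let mI n : measurable_fun [set: O] (\1_(GX n) : O -> R).
Proof. exact: measurable_indic. Qed.

Let I0 n w : (0 <= \1_(GX n) w :> R)%R. Proof. by []. Qed.

Let ms n : measurable_fun [set: O] (sample X n).
Proof. exact: measurable_sample. Qed.

(** Both sides are finite measures in [A]. On a rectangle independence factors them and [hE] matches
    the factors; rectangles form a generating pi-system, so the measures coincide. *)
Lemma likelihood_sample n (A : set (n.-tuple S)) : measurable A ->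
  \int[Pr1]_(w in sample X n @^-1` A) (\prod_(i < n) h (X i w))%:E =
  Pr0 (sample X n @^-1` A `&` [set w | forall i : 'I_n, G (X i w)]).
Proof.
move=> mA.
have msA (C : set (n.-tuple S)) : measurable C ->
    measurable (sample X n @^-1` C).
  by move=> mC; rewrite -[_ @^-1` _]setTI; exact: measurable_sample.
have I_E C : measurable C -> density_image Pr0 (@ms n) (@mI n) (@I0 n) C =
    Pr0 (sample X n @^-1` C `&` GX n).
  move=> mC; rewrite /density_image (integral_indic Pr0 (msA _ mC) (mGX n)).
  by rewrite setIC.
rewrite -[RHS]I_E// -[LHS]/(density_image Pr1 (@ms n) (@mL n) (@L0 n) A).
have LI C : @rectangles dS S n C ->
    density_image Pr1 (@ms n) (@mL n) (@L0 n) C =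
    density_image Pr0 (@ms n) (@mI n) (@I0 n) C.
  move=> RC; rewrite I_E; last first.
    by rewrite measurable_tuple_rectangles; exact: sub_sigma_algebra.
  case: RC => B mB <-.
  have -> : sample X n @^-1` rectangle B `&` GX n =
      [set w | forall i : 'I_n, (B i `&` G) (X i w)].
    apply/seteqP; split => [w [/= Bw Gw] i|w BG].
      by split; [have := Bw i; rewrite tnth_mktuple|exact: Gw].
    by split => i; have [] := BG i; rewrite // tnth_mktuple.
  have [_ PX0 indX0] := iid0.
  rewrite (independent_prob_all_ord _ indX0 (B := fun i => B i `&` G)).
  2: by move=> i; exact: measurableI.
  transitivity (\int[Pr1]_w (\prod_(i < n) (h \* \1_(B i))%R (X i w))%:E).
    rewrite /density_image integral_mkcond; apply: eq_integral => w _.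
    rewrite patchE; case: ifPn => [|].
      rewrite inE => /= Bw; congr EFin; apply: eq_bigr => i _ /=.
      by rewrite indicE mem_set ?mulr1//; have := Bw i; rewrite tnth_mktuple.
    rewrite notin_setE => /= /existsNP[i]; rewrite tnth_mktuple => Bi.
    by rewrite (bigD1 i)//= indicE memNset// mulr0 mul0r.
  have hB i : \int[P1]_x ((h \* \1_(B i))%R x)%:E = P0 (B i `&` G).
    rewrite -hE// [RHS]integral_mkcond; apply: eq_integral => x _.
    by rewrite patchE /= indicE; case: ifP; rewrite ?mulr1 ?mulr0.
  rewrite (integral_prod_indep iid1 _ (phi := fun i => (h \* \1_(B i))%R)).
  - by apply: eq_bigr => i _; rewrite hB PX0//; exact: measurableI.
  - by move=> i; exact: measurable_funM.
  - by move=> i x; rewrite /= mulr_ge0.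
  - move=> i; rewrite hB (le_lt_trans (probability_le1 _ _)) ?ltry//.
    exact: measurableI.
have RT : @rectangles dS S n (@setT (n.-tuple S)).
  by exists (fun=> setT) => //; apply/seteqP; split.
(* The exhausting sequence is constantly the whole space, a rectangle of mass at most 1. *)
apply: (measure_unique (@rectangles dS S n) (fun=> setT)) => //.
- exact: measurable_tuple_rectangles.
- exact: setI_closed_rectangles.
- by rewrite bigcup_const//; exists 0%N.
- move=> _; apply: (@le_lt_trans _ _ 1); last exact: ltry.
  rewrite [leLHS]LI// I_E//; apply: probability_le1.
  by apply: measurableI => //; exact: msA.
Qed.

End likelihood.

(** * Jensen's inequality for the exponential on an event *)

Lemma jensen_expR_ge (R : realType) (dO : measure_display)
    (O : measurableType dO) (m : probability O R) (lam : O -> R) (W : set O) :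
  measurable W -> m.-integrable [set: O] (EFin \o lam) ->
  (\int[m]_w (expR (lam w))%:E <= 1)%E -> 0 < fine (m W) ->
  fine (m W) * expR ((\int[m]_w lam w - 1) / fine (m W)) <=
    \int[m]_(w in W) expR (lam w).
Proof.
move=> mW ilam e1; set p := fine (m W) => p0.
have mlam : measurable_fun [set: O] lam.
  by apply/measurable_EFinP; exact: measurable_int ilam.
have ie : m.-integrable [set: O] (EFin \o (expR \o lam)).
  apply/integrableP; split.
    by apply/measurable_EFinP; exact: measurableT_comp.
  under eq_integral do rewrite /= ger0_norm ?expR_ge0//.
  by rewrite (le_lt_trans e1)// ltry.
have mC : measurable (~` W) by exact: measurableC.
have iS (f : O -> R) A : measurable A -> m.-integrable [set: O] (EFin \o f) ->
  m.-integrable A (EFin \o f) by move=> mA; exact: integrableS.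
have split_int (f : O -> R) : m.-integrable [set: O] (EFin \o f) ->
    \int[m]_w f w = \int[m]_(w in W) f w + \int[m]_(w in ~` W) f w.
  move=> fi; rewrite -Rintegral_setU ?setUv//.
  by apply/disj_setPS; rewrite setICr.
(* Off [W], the bound [lam <= 1 + lam <= expR lam] caps the integral of [lam] by the total
   exponential mass. *)
have IC : \int[m]_(w in ~` W) lam w <= 1.
  apply: (@le_trans _ _ (\int[m]_(w in ~` W) expR (lam w))).
    apply: le_Rintegral => //; [exact: iS|exact: iS|] => w _.
    by rewrite (le_trans _ (expR_ge1Dx _))// lerDr.
  rewrite (@le_trans _ _ (\int[m]_w expR (lam w)))//.
    by rewrite [leRHS]split_int// lerDr Rintegral_ge0// => w _; exact: expR_ge0.
  have : ((\int[m]_w expR (lam w))%R%:E <= 1)%E.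
    by rewrite /Rintegral fineK//; exact: integrable_fin_num.
  by rewrite lee_fin.
set IW := \int[m]_(w in W) lam w.
have IWE : \int[m]_w lam w - 1 <= IW.
  by rewrite (split_int _ ilam) lerBlDr lerD2l.
(* Tangent line of exp at the mean t of lam on W. *)
set t := IW / p.
apply: (@le_trans _ _ (p * expR t)).
  by rewrite ler_pM2l// ler_expR ler_pM2r ?invr_gt0.
have ic (c : R) : m.-integrable W (EFin \o cst c).
  exact: finite_measure_integrable_cst.
have iD : m.-integrable W (EFin \o (fun w => lam w + (1 - t))).
  exact: (integrableD mW (iS _ _ mW ilam) (ic (1 - t))).
(* As [lam] has mean [t] on [W], the tangent line integrates over [W] to exactly [p * expR t]. *)
apply: (@le_trans _ _ (\int[m]_(w in W) (expR t * (lam w + (1 - t))))).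
  rewrite RintegralZl//.
  rewrite RintegralD//; [|exact: iS|exact: ic].
  rewrite Rintegral_cst// -/IW -/p mulrC ler_pM2l ?expR_gt0//.
  by rewrite mulrBl mul1r /t divfK ?gt_eqF// addrC subrK.
apply: le_Rintegral => //.
- exact: (integrableZl mW (expR t) iD).
- exact: iS.
- move=> w _; rewrite -[in leRHS](subrK t (lam w)) expRD mulrC.
  rewrite ler_pM2r ?expR_gt0//.
  by rewrite (le_trans _ (expR_ge1Dx _))// addrCA.
Qed.

(** * Log-likelihood ratio and Kullback-Leibler divergence *)

Definition llr (R : realType) (S : Type) (f0 f1 : S -> R) (x : S) : R :=
  ln (f0 x) - ln (f1 x).

(* Junk values: in \bar R, 0^-1 = +oo, lne 0 = -oo and 0 * y = 0, so this is 0
   where f1 = 0 and +oo where f1 > 0 = f0. *)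
Definition kl_integrand (R : realType) (S : Type) (f0 f1 : S -> R) (x : S) :
    \bar R :=
  (lne ((f1 x)%:E / (f0 x)%:E) * (f1 x)%:E)%E.

Section kullback_leibler.
Context (R : realType) (dS : measure_display) (S : measurableType dS).
Variables (mu P0 P1 : probability S R) (f0 f1 : S -> R).
Hypotheses (df0 : is_density mu P0 f0) (df1 : is_density mu P1 f1).

Local Notation u := (kl_integrand f0 f1).
Local Notation l := (llr f0 f1).

Let mf0 : measurable_fun [set: S] f0. Proof. by have [] := df0. Qed.
Let mf1 : measurable_fun [set: S] f1. Proof. by have [] := df1. Qed.
Let f0_ge0 x : 0 <= f0 x. Proof. by have [] := df0. Qed.
Let f1_ge0 x : 0 <= f1 x. Proof. by have [] := df1. Qed.

Let b (x : S) := (0 < f1 x) && (f0 x <= 0).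

(** [b] marks the points where [f1] is positive and [f0] is zero, the only ones where the divergence
    integrand is infinite. Where [f1] vanishes, the default value of [ln] at 0 is absorbed by the
    factor [f1]. *)
Let uE x : u x = if b x then +oo%E else (- l x * f1 x)%:E.
Proof.
rewrite /kl_integrand /b /llr; case: ifPn => [/andP[p1 n0]|].
  have -> : f0 x = 0 by apply/eqP; rewrite eq_le n0 f0_ge0.
  by rewrite inve0 gt0_muley ?lte_fin// gt0_mulye ?lte_fin.
rewrite negb_and -leNgt -ltNge => nb.
have [f10|f1N] := eqVneq (f1 x) 0; first by rewrite f10 mule0 mulr0.
have p1 : 0 < f1 x by rewrite lt0r f1N f1_ge0.
have p0 : 0 < f0 x by move: nb; rewrite leNgt p1.
rewrite inver gt_eqF// -EFinM lne_EFin ?divr_gt0// ln_div ?posrE//.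
by rewrite opprB.
Qed.

Lemma measurable_llr : measurable_fun [set: S] l.
Proof.
by apply: measurable_funB; apply: measurableT_comp => //; exact: measurable_ln.
Qed.

Let ml := measurable_llr.

Let mlf1 : measurable_fun [set: S] (fun x => - l x * f1 x).
Proof. by apply: measurable_funM => //; exact: measurableT_comp. Qed.

Let mb : measurable_fun [set: S] b.
Proof.
apply: measurable_and.
- exact: measurable_fun_ltr.
- exact: measurable_fun_ler.
Qed.

Let mu_ : measurable_fun [set: S] u.
Proof.
rewrite (_ : u = fun x => if b x then +oo%E else (- l x * f1 x)%:E).
  by apply: measurable_fun_ifT => //; exact/measurable_EFinP.
by apply/funext => x; exact: uE.
Qed.

(** When both densities are positive, [ln y < y] at [y = f0 x / f1 x] gives [l x * f1 x <= f0 x].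
    The negative part of [u] is thus dominated by [f0]. *)
Let u_ge x : (- (f0 x)%:E <= u x)%E.
Proof.
rewrite uE; case: ifPn => [_|]; first exact: leey.
rewrite /b negb_and -leNgt -ltNge => nb.
have [f10|f1N] := eqVneq (f1 x) 0.
  by rewrite f10 mulr0 leeNl oppe0 lee_fin.
have p1 : 0 < f1 x by rewrite lt0r f1N f1_ge0.
rewrite -EFinN lee_fin mulNr lerN2 /llr.
have p0 : 0 < f0 x by move: nb; rewrite leNgt p1.
rewrite -ln_div ?posrE// -ler_pdivlMr//.
by apply/ltW/ln_sublinear; rewrite divr_gt0.
Qed.

Hypothesis KL_lty : (\int[mu]_x u x < +oo)%E.
Local Open Scope ereal_scope.

Let int_f0 : \int[mu]_x (f0 x)%:E = 1.
Proof. by have [_ _ <-//] := df0; exact: probability_setT. Qed.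

(** The negative part has integral at most that of [f0], which is 1, so a divergence below +oo
    forces the positive part to be integrable too. *)
Let integrable_u : mu.-integrable [set: S] u.
Proof.
have un : \int[mu]_x u^\- x < +oo.
  apply: (@le_lt_trans _ _ (\int[mu]_x (f0 x)%:E)); last by rewrite int_f0 ltry.
  apply: ge0_le_integral => //.
  - exact: measurable_funeneg.
  - exact/measurable_EFinP.
  - move=> x _; rewrite funenegE ge_max lee_fin f0_ge0 andbT.
    by rewrite leeNl.
apply/integrableP; split; first exact: mu_.
rewrite -[fun x => _]/(abse \o u) fune_abse ge0_integralD//; last 2 first.
- exact: measurable_funepos.
- exact: measurable_funeneg.
apply: lte_add_pinfty => //.
move: KL_lty; rewrite [X in X < _ -> _]integralE; move: un.
have : 0 <= \int[mu]_x u^\- x by exact: integral_ge0.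
case: (\int[mu]_x u^\- x) => [r| |]// _ _.
by case: (\int[mu]_x u^\+ x) => [s| |]//= *; rewrite ?ltry.
Qed.

(** An integrable function is finite almost everywhere, hence [f0 > 0] almost everywhere on
    [f1 > 0]. *)
Let nb_ae : {ae mu, forall x, ~~ b x}.
Proof.
have := integrable_ae measurableT integrable_u.
by apply: filterS => x /(_ I); rewrite uE; case: ifP.
Qed.

Let uE_ae : ae_eq mu setT u (fun x => (- l x * f1 x)%:E).
Proof. by apply: filterS nb_ae => x /negPf bx _; rewrite uE bx. Qed.

Let mid : measurable_fun [set: S] (@id S). Proof. exact: measurable_id. Qed.

Let nuE (B : set S) : measurable B ->
  \int[mu]_(x in id @^-1` B) (f1 x)%:E = P1 B.
Proof. by move=> mB; have [_ _ ->] := df1. Qed.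

Let integrable_lf1 : mu.-integrable [set: S] (fun x => (l x * f1 x)%:E).
Proof.
apply: (le_integrable _ _ _ integrable_u) => //.
- by apply/measurable_EFinP; exact: measurable_funM.
- move=> x _; rewrite uE; case: ifP => _; first by rewrite leey.
  by rewrite mulNr EFinN abseN.
Qed.

Lemma integrable_llr : P1.-integrable [set: S] (EFin \o l).
Proof.
by have [H _] := integrable_density mid mf1 f1_ge0 nuE ml; exact: H.
Qed.

Lemma integral_llr : \int[P1]_x (l x)%:E = - \int[mu]_x u x.
Proof.
rewrite -(integral_density mid mf1 f1_ge0 nuE ml).
rewrite (ae_eq_integral _ _ _ _ _ uE_ae)//; last exact/measurable_EFinP.
rewrite -integralN.
  by apply: eq_integral => x _; rewrite mulNr EFinN oppeK.
apply: integrable_add_def => //.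
apply: eq_integrable (integrableN integrable_lf1) => // x _.
by rewrite /= mulNr EFinN.
Qed.

(** Almost everywhere on [f1 > 0] one has [expR (l x) * f1 x = f0 x], while the zeros of [f1]
    contribute nothing to the left side. [P0] may charge those zeros, hence the intersection on the
    right. *)
Lemma integral_likelihood_ratio (B : set S) : measurable B ->
  \int[P1]_(x in B) (expR (l x))%:E = P0 (B `&` [set x | (0 < f1 x)%R]).
Proof.
move=> mB.
have mG : measurable [set x | (0 < f1 x)%R].
  rewrite -[X in measurable X]setTI.
  by apply: (measurable_fun_ltr (f := cst 0%R)) => //.
have mBG : measurable (B `&` [set x | (0 < f1 x)%R]) by exact: measurableI.
have mel : measurable_fun [set: S] (fun x => expR (l x)).
  exact: measurableT_comp.
have [_ _ ->//] := df0.
rewrite integral_mkcond [RHS]integral_mkcond.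
rewrite -(ge0_integral_density mid mf1 f1_ge0 nuE); last 2 first.
- apply/(measurable_restrictT _ mB); apply/measurable_funTS.
  exact/measurable_EFinP.
- by move=> x; apply: erestrict_ge0 => y _; rewrite lee_fin expR_ge0.
apply: ae_eq_integral => //.
- apply: emeasurable_funM; last exact/measurable_EFinP.
  apply/(measurable_restrictT _ mB); apply/measurable_funTS.
  exact/measurable_EFinP.
- apply/(measurable_restrictT _ mBG); apply/measurable_funTS.
  exact/measurable_EFinP.
apply: filterS nb_ae => x; rewrite /b negb_and -leNgt -ltNge => bx _.
rewrite !patchE in_setI; case: (x \in B) => /=; last by rewrite mul0e.
case: ifPn => [|]; rewrite ?notin_setE ?inE/=.
  move=> p1; have p0 : (0 < f0 x)%R by move: bx; rewrite leNgt p1.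
  by rewrite -EFinM /llr expRD expRN !lnK ?posrE// divfK// gt_eqF.
move=> /negP; rewrite -leNgt => f10.
have -> : f1 x = 0%R by apply/eqP; rewrite eq_le f10 f1_ge0.
by rewrite mule0.
Qed.

End kullback_leibler.

(** * Lower bound at a fixed sample size *)

Section entropy_bound.
Context (R : realType) (dO dS : measure_display).
Context (O : measurableType dO) (S : measurableType dS).
Variables (Pr0 Pr1 : probability O R) (X : nat -> O -> S).
Variables (P0 P1 : probability S R) (l : S -> R) (G : set S).
Hypotheses (iid0 : iid_with_law Pr0 X P0) (iid1 : iid_with_law Pr1 X P1).
Hypotheses (ml : measurable_fun [set: S] l) (mG : measurable G).
Hypothesis il : P1.-integrable [set: S] (EFin \o l).
Hypothesis lE : forall B, measurable B ->
  (\int[P1]_(x in B) (expR (l x))%:E = P0 (B `&` G))%E.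

Let mX i : measurable_fun [set: O] (X i). Proof. by have [] := iid0. Qed.

(** With density constantly 1, the change of variables turns expectations of functions of [X i] into
    integrals against [P1]. *)
Let PrX1 i (B : set S) : measurable B ->
  (\int[Pr1]_(w in X i @^-1` B) (cst 1%R w)%:E = P1 B)%E.
Proof.
move=> mB; have [_ PX _] := iid1; rewrite -(PX i)//.
rewrite (eq_integral (cst 1%E))// integral_cst ?mul1e//.
by rewrite -[_ @^-1` _]setTI; exact: mX.
Qed.

Let m1 : measurable_fun [set: O] (cst (1 : R)).
Proof. exact: measurable_cst. Qed.

Let c1 (w : O) : 0 <= cst (1 : R) w. Proof. by []. Qed.

Let ilX i : Pr1.-integrable [set: O] (EFin \o (fun w => l (X i w))).
Proof.
have [_ /(_ il)] := integrable_density (mX i) m1 c1 (@PrX1 i) ml.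
by apply: eq_integrable => // w _ /=; rewrite mulr1.
Qed.

Let intX i : (\int[Pr1]_w (l (X i w))%:E = (\int[P1]_x l x)%:E)%E.
Proof.
rewrite /Rintegral fineK; last exact: integrable_fin_num.
rewrite -(integral_density (mX i) m1 c1 (@PrX1 i) ml).
by apply: eq_integral => w _ /=; rewrite mulr1.
Qed.

Let ilam n : Pr1.-integrable [set: O]
  (EFin \o (fun w => \sum_(i < n) l (X i w))).
Proof.
have H : Pr1.-integrable [set: O]
    (fun w => \sum_(i < n) (l (X i w))%:E)%E.
  by apply: integrable_sum => // i _; exact: ilX.
by apply: eq_integrable H => // w _ /=; rewrite sumEFin.
Qed.

Let intlam n : \int[Pr1]_w (\sum_(i < n) l (X i w)) = n%:R * \int[P1]_x l x.
Proof.
rewrite [LHS]/Rintegral; under eq_integral do rewrite -sumEFin.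
rewrite integral_sum//; last by move=> i; exact: ilX.
under eq_bigr do rewrite intX.
by rewrite sumEFin [LHS]/= sumr_const card_ord mulr_natl.
Qed.

Lemma probability_sample_ge n (A : set (n.-tuple S)) : measurable A ->
  let p := fine (Pr1 (sample X n @^-1` A)) in 0 < p ->
  ((p * expR ((n%:R * \int[P1]_x l x - 1) / p))%:E <=
    Pr0 (sample X n @^-1` A))%E.
Proof.
move=> mA p p0.
have msA : measurable (sample X n @^-1` A).
  by rewrite -[_ @^-1` _]setTI; exact: measurable_sample.
(* Only an inequality: the part of [Pr0] where some observation leaves [G] is dropped. The full
   space as [C] gives the mass bound for Jensen's inequality, and [A] as [C] gives the final
   comparison. *)
have LE (C : set (n.-tuple S)) : measurable C ->
    (\int[Pr1]_(w in sample X n @^-1` C) (expR (\sum_(i < n) l (X i w)))%:E <=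
     Pr0 (sample X n @^-1` C))%E.
  move=> mC; under eq_integral do rewrite expR_sum.
  rewrite (likelihood_sample iid0 iid1 (h := expR \o l) (G := G))//.
  - apply: le_measure => //; rewrite inE.
      apply: measurableI; last first.
        exact: (@measurable_all_ord _ _ _ _ X n (fun=> G)).
      by rewrite -[_ @^-1` _]setTI; exact: measurable_sample.
    by rewrite -[_ @^-1` _]setTI; exact: measurable_sample.
  - exact: measurableT_comp.
  - by move=> x; exact: expR_ge0.
have e1 : (\int[Pr1]_w (expR (\sum_(i < n) l (X i w)))%:E <= 1)%E.
  by rewrite (le_trans (LE setT measurableT))// probability_setT.
have := jensen_expR_ge msA (ilam n) e1 p0.
rewrite intlam -/p -lee_fin => /le_trans; apply.
rewrite /Rintegral fineK; first exact: LE.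
rewrite ge0_fin_numE; last first.
  by apply: integral_ge0 => w _; rewrite lee_fin expR_ge0.
by rewrite (le_lt_trans (LE _ mA))// (le_lt_trans (probability_le1 _ _)) ?ltry.
Qed.

End entropy_bound.

(** * Passage to the limit inferior *)

Lemma limn_einf_log_ge (R : realType) (q : nat -> \bar R) (p : nat -> R)
    (c : R) :
  p @ \oo --> (1 : R) ->
  (forall n, 0 < p n -> ((p n * expR ((n%:R * c - 1) / p n))%:E <= q n)%E) ->
  (c%:E <= limn_einf (fun n => (n%:R^-1)%:E * lne (q n)))%E.
Proof.
move=> p1 pq.
(* This is the logarithm of the lower bound at [n.+1], divided by [n.+1]; the shift avoids the
   inverse of 0. *)
pose b n : R := n.+1%:R^-1 * ln (p n.+1) + (c - n.+1%:R^-1) / p n.+1.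
have bc : b @ \oo --> c.
  have pS : (fun n => p n.+1) @ \oo --> (1 : R) by rewrite (cvg_shiftS p).
  have nS : (fun n => n.+1%:R^-1 : R) @ \oo --> (0 : R) by exact: cvg_harmonic.
  rewrite (_ : c = 0 * ln 1 + (c - 0) / 1); last first.
    by rewrite mul0r add0r subr0 divr1.
  apply: cvgD.
    apply: cvgM => //; apply: (continuous_cvg _ _ pS).
    by apply: continuous_ln; exact: ltr01.
  apply: cvgM; first by apply: cvgB => //; exact: cvg_cst.
  by apply: cvgV => //; exact: oner_neq0.
apply/lee_subgt0Pr => e e0.
rewrite limn_einf_lim; apply: lime_ge; first exact: is_cvg_einfs.
have [N _ HN] : \forall n \near \oo, 0 < p n.+1 /\ c - e <= b n.
  have pS : (fun n => p n.+1) @ \oo --> (1 : R) by rewrite (cvg_shiftS p).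
  near=> n; split; near: n.
    by apply: (cvgr_gt 1 pS); exact: ltr01.
  by apply: (cvgr_ge c bc); rewrite ltrBlDr ltrDl.
(* Because [b] is shifted, the tail starts at [N.+1]: each of its indices is the successor of some
   index at least [N]. *)
exists N.+1 => // m /= Nm; apply: le_ereal_inf_tmp => _ [k /= mk <-].
have {m Nm mk} : (N < k)%N by exact: leq_trans mk.
case: k => // k Nk; have [pk bk] := HN k Nk.
rewrite (le_trans (y := (b k)%:E)) ?lee_fin//.
have n0 : 0 < (k.+1)%:R :> R by rewrite ltr0n.
have bE : b k = k.+1%:R^-1 * ln (p k.+1 * expR ((k.+1%:R * c - 1) / p k.+1)).
  rewrite lnM ?posrE ?expR_gt0// expRK mulrDr; congr (_ + _).
  rewrite mulrA; congr (_ / _).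
  by rewrite mulrBr mulrA mulVf ?gt_eqF// mul1r mulr1.
rewrite bE EFinM; apply: lee_wpmul2l; first by rewrite lee_fin invr_ge0 ltW.
have l0 : 0 < p k.+1 * expR ((k.+1%:R * c - 1) / p k.+1).
  by rewrite mulr_gt0// expR_gt0.
rewrite -lne_EFin// lee_lne//; first exact: pq.
- by rewrite in_itv/= leey andbT lee_fin ltW.
- by rewrite in_itv/= leey andbT (le_trans _ (pq _ pk))// lee_fin ltW.
Unshelve. all: by end_near. Qed.

(** * The Euclidean norm and the topology of row vectors *)

Section euclidean_norm.
Context (R : realType) (d : nat).

Lemma normr_coord_le_enorm (v : 'rV[R]_d) (i : 'I_d) : `|v ord0 i| <= enorm v.
Proof.
rewrite -sqrtr_sqr; apply: ler_wsqrtr.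
by rewrite (bigD1 i)//= lerDl sumr_ge0// => j _; exact: sqr_ge0.
Qed.

Lemma continuous_enorm : continuous (@enorm R d).
Proof.
move=> v; rewrite /enorm.
apply: (continuous_comp (f := fun v : 'rV[R]_d => \sum_(i < d) v ord0 i ^+ 2));
  last exact: sqrt_continuous.
apply: continuous_big => [|i _ w]; first exact: add_continuous.
have ci := @coord_continuous R 1 d ord0 i w.
exact: (cvgM ci ci).
Qed.

Lemma continuous_subr (a : 'rV[R]_d) : continuous (fun v : 'rV[R]_d => v - a).
Proof. by move=> v; exact: (cvgB cvg_id (cvg_cst a)). Qed.

Lemma open_enorm_gt (a : 'rV[R]_d) (e : R) :
  open [set v : 'rV[R]_d | e < enorm (v - a)].
Proof.
rewrite (_ : mkset _ = (enorm (d := d) \o (fun v : 'rV[R]_d => v - a)) @^-1`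
  [set x | e < x])//.
apply: open_comp; last exact: open_gt.
move=> v _; apply: continuous_comp; first exact: continuous_subr.
exact: continuous_enorm.
Qed.

Lemma open_subr (a : 'rV[R]_d) (A : set 'rV[R]_d) :
  open A -> open [set v | A (v - a)].
Proof.
move=> oA; rewrite (_ : mkset _ = (fun v : 'rV[R]_d => v - a) @^-1` A)//.
by apply: open_comp => // v _; exact: continuous_subr.
Qed.

Lemma open_enorm_ball (A : set 'rV[R]_d) (u : 'rV[R]_d) : open A -> A u ->
  exists2 e, 0 < e & forall v, enorm (v - u) <= e -> A v.
Proof.
move=> oA Au; have /nbhs_ballP[e /= e0 eA] := open_nbhs_nbhs (conj oA Au).
(* Each coordinate is bounded by the Euclidean norm; halving turns the closed condition into the
   strict inequality of the sup-norm ball. *)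
exists (e / 2); first by rewrite divr_gt0.
move=> v ve; apply: eA; split => // i j; rewrite /ball /= (ord1 i).
rewrite distrC (le_lt_trans (y := e / 2)) ?ltr_pdivrMr ?ltr_pMr ?ltr1n//.
rewrite (le_trans _ ve)//.
by have := normr_coord_le_enorm (v - u) j; rewrite !mxE.
Qed.

End euclidean_norm.

(** * Consistency in terms of open neighbourhoods *)

Lemma borel_measurable_preimage (R : realType) (d : nat) (dT : measure_display)
    (T : measurableType dT) (g : T -> 'rV[R]_d) (A : set 'rV[R]_d) :
  borel_measurable g -> open A -> measurable (g @^-1` A).
Proof.
move=> mg oA; rewrite -[_ @^-1` _]setTI; apply: mg => //.
exact: sub_sigma_algebra.
Qed.

(** An open [A] contains a closed Euclidean ball around [theta], so the probability of missing [A]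
    is at most that of an error above its radius, which tends to 0. *)
Lemma consistent_prob_open (R : realType) (d : nat) (dO dS : measure_display)
    (O : measurableType dO) (S : measurableType dS)
    (Theta : set 'rV[R]_d) (Pr : 'rV[R]_d -> probability O R)
    (X : nat -> O -> S) (est : forall n : nat, n.-tuple S -> 'rV[R]_d)
    (theta : 'rV[R]_d) (A : set 'rV[R]_d) :
  (forall i, measurable_fun [set: O] (X i)) ->
  (forall n, borel_measurable (est n)) ->
  consistent Theta Pr X est -> Theta theta -> open A -> A theta ->
  fine (Pr theta [set w | A (est n (sample X n w))]) @[n --> \oo] --> (1 : R).
Proof.
move=> mX mest cest Ttheta oA Atheta.
have [e e0 eA] := open_enorm_ball oA Atheta.
pose B n := [set w | e < enorm (est n (sample X n w) - theta)].
have mE n (C : set 'rV[R]_d) : open C ->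
    measurable [set w | C (est n (sample X n w))].
  move=> oC; have mC := borel_measurable_preimage (mest n) oC.
  by rewrite -[X in measurable X]setTI; exact: (measurable_sample mX _ mC).
have mB n : measurable (B n)
  by exact: (mE _ _ (@open_enorm_gt R d theta e)).
have B0 : (fun n => 1 - fine (Pr theta (B n))) @ \oo --> (1 : R).
  rewrite -[X in _ --> X]subr0; apply: cvgB; first exact: cvg_cst.
  exact: (fine_cvg (cest theta Ttheta e e0)).
have c1 : (fun=> 1 : R) @ \oo --> (1 : R) by exact: cvg_cst.
apply: (squeeze_cvgr _ B0 c1); apply: nearW => n.
have pfin C : measurable C -> Pr theta C \is a fin_num.
  by move=> mC; exact: fin_num_measure.
have mA := @mE n _ oA.
apply/andP; split; last by rewrite -lee_fin fineK ?pfin// probability_le1.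
rewrite -lee_fin EFinB !fineK ?pfin// -probability_setC//.
apply: le_measure; rewrite ?inE//; first exact: measurableC.
by move=> w /negP; rewrite /= -leNgt; exact: eA.
Qed.

(** * The large-deviation lower bound for consistent estimators *)

Theorem theorem2p8 (R : realType) (d : nat) (dS dO : measure_display)
    (S : measurableType dS) (O : measurableType dO)
    (Theta : set 'rV[R]_d) (mu : probability S R)
    (P : 'rV[R]_d -> probability S R) (f : S -> 'rV[R]_d -> R)
    (Pr : 'rV[R]_d -> probability O R) (X : nat -> O -> S)
    (est : forall n : nat, n.-tuple S -> 'rV[R]_d)
    (theta0 : 'rV[R]_d) (Omega : set 'rV[R]_d) :
  open Theta ->
  (forall theta, Theta theta -> P theta `<< mu) ->
  (forall theta, Theta theta -> is_density mu (P theta) (f ^~ theta)) ->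
  (forall theta, Theta theta -> iid_with_law (Pr theta) X (P theta)) ->
  (forall n, borel_measurable (est n)) ->
  consistent Theta Pr X est ->
  Theta theta0 ->
  open Omega ->
  ~ Omega 0 ->
  [set theta0 + u | u in Omega] `<=` Theta ->
  forall theta1 : 'rV[R]_d, [set theta0 + u | u in Omega] theta1 ->
  (- (\int[mu]_x (lne ((f x theta1)%:E / (f x theta0)%:E) * (f x theta1)%:E))
   <= limn_einf (fun n : nat =>
        (n%:R^-1)%:E *
        lne (Pr theta0 [set w | Omega (est n (sample X n w) - theta0)%R])))%E.
Proof.
move=> _ _ df iidX mest cest T0 oOmega _ OmegaT theta1 O1.
have T1 := OmegaT _ O1.
have [df0 df1] := (df _ T0, df _ T1).
have [iid0 iid1] := (iidX _ T0, iidX _ T1).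
rewrite -/(kl_integrand (f ^~ theta0) (f ^~ theta1) _).
(* If the divergence is +oo, the left side is -oo and the bound is trivial. *)
have [|KLoo] :=
  leP +oo%E (\int[mu]_x kl_integrand (f ^~ theta0) (f ^~ theta1) x)%E.
  by rewrite leye_eq => /eqP ->; rewrite leNye.
have il := integrable_llr df0 df1 KLoo.
rewrite -(integral_llr df0 df1 KLoo) -[leLHS]fineK; last first.
  exact: integrable_fin_num.
have mX i : measurable_fun [set: O] (X i) by have [] := iid0.
(* This is [theta0 + Omega], an open neighbourhood of [theta1]: consistency is used under [theta1],
   whereas the probability to be bounded is under [theta0]. *)
pose A := [set v : 'rV[R]_d | Omega (v - theta0)].
have oA : open A by exact: open_subr.
have A1 : A theta1.
  by case: O1 => u Ou <-; rewrite /A /= addrAC subrr add0r.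
apply: (limn_einf_log_ge (consistent_prob_open mX mest cest T1 oA A1)) => n p0.
apply: (probability_sample_ge iid0 iid1 (measurable_llr df0 df1) _ il
  (G := [set x | 0 < f x theta1]) _ (A := est n @^-1` A)) => //.
- have [mf1 _ _] := df1.
  rewrite -[X in measurable X]setTI.
  by apply: (measurable_fun_ltr (f := cst 0)).
- by move=> B mB; exact: (integral_likelihood_ratio df0 df1 KLoo mB).
- exact: borel_measurable_preimage.
Qed.
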